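(* Let $\lambda,\mu>0$ and let $n,k\ge 1$ be integers. Let $O^{(1)}_{n,n+k}$ and $O^{(2)}_{n,n+k}$ be the overlap times of the $n$-th and $(n+k)$-th customers in stations 1 and 2 of the $(M/M/\infty)^2$ tandem queue with arrival rate $\lambda$ and with both stations having exponential service times of the same rate $\mu$. Then for all $x,y\ge 0$, $$\mathbb{P}\left(O^{(1)}_{n,n+k}>x,\ O^{(2)}_{n,n+k}>y\right)=\frac{e^{-2\mu(x+y)}}{2}\left(\frac{\lambda}{\lambda+\mu}\right)^{k}.$$
   Context: The $(M/M/\infty)^2$ tandem queue with identically distributed stations: customers $1,2,3,\dots$ arrive at station 1 at the successive points $A_1<A_2<\cdots$ of a Poisson process of rate $\lambda$, so the inter-arrival times $A_{i+1}-A_i$ are i.i.d. exponential with rate $\lambda$. Each station has infinitely many servers; customer $i$ receives service of duration $S^{(1)}_i$ at station 1 starting at time $A_i$, then immediately moves to station 2 and receives service of duration $S^{(2)}_i$. All service times $S^{(j)}_i$ ($j=1,2$, $i\ge 1$) are i.i.d. exponential with rate $\mu$ (mean $1/\mu$) and independent of the arrival process. Put $D^{(0)}_i=A_i$ and $D^{(j)}_i=A_i+\sum_{l=1}^{j}S^{(l)}_i$, the departure time of customer $i$ from station $j$. The overlap time of customers $n$ and $n+k$ in station $j$ is $$O^{(j)}_{n,n+k}=\left(\min\left(D^{(j)}_n,D^{(j)}_{n+k}\right)-\max\left(D^{(j-1)}_n,D^{(j-1)}_{n+k}\right)\right)^+,\qquad j=1,2,$$ where $z^+=\max(z,0)$.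 *)

(* Defs.v *)
From HB Require Import structures.
From mathcomp Require Import all_boot all_order all_algebra finmap.
From mathcomp Require Import all_classical all_reals all_analysis.
From mathcomp Require Import measurable_realfun.

Set Implicit Arguments.
Unset Strict Implicit.
Unset Printing Implicit Defensive.

Import Order.TTheory GRing.Theory Num.Theory.

Local Open Scope classical_set_scope.
Local Open Scope ring_scope.

Definition mutually_independent d (T : measurableType d) (R : realType)
    (P : probability T R) (I : choiceType) (D : set I)
    (X : I -> {RV P >-> R}) : Prop :=
  forall J : {fset I}, [set` J] `<=` D ->
  forall B : I -> set R, (forall i, measurable (B i)) ->
  P (\bigcap_(i in [set` J]) X i @^-1` B i) =
  (\prod_(i <- J) P (X i @^-1` B i))%E.

(* The laws are compared on measurable sets only: [exponential_prob r] is an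
   integral that makes sense for every set, and its value on non-measurable
   sets carries no probabilistic content. *)
Definition exponential_rv d (T : measurableType d) (R : realType)
    (P : probability T R) (r : R) (X : {RV P >-> R}) : Prop :=
  forall B : set R, measurable B ->
    distribution P X B = exponential_prob r B.

Definition iid_exponential d (T : measurableType d) (R : realType)
    (P : probability T R) (I : choiceType) (D : set I) (r : R)
    (X : I -> {RV P >-> R}) : Prop :=
  mutually_independent D X /\ (forall i, D i -> exponential_rv r (X i)).

Definition sigma_generated d (T : measurableType d) (R : realType)
    (P : probability T R) (I : Type) (D : set I)
    (X : I -> {RV P >-> R}) : set (set T) :=
  <<s \bigcup_(i in D) preimage_set_system setT (X i) measurable >>.

Definition independent_families d (T : measurableType d) (R : realType)
    (P : probability T R) (I J : Type) (D : set I) (E : set J)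
    (X : I -> {RV P >-> R}) (Y : J -> {RV P >-> R}) : Prop :=
  forall U V : set T, sigma_generated D X U -> sigma_generated E Y V ->
    P (U `&` V) = (P U * P V)%E.

Definition interarrival d (T : measurableType d) (R : realType)
    (P : probability T R) (A : nat -> {RV P >-> R}) (i : nat) : {RV P >-> R} :=
  (A i.+1 : {mfun T >-> R}) - (A i : {mfun T >-> R}).

(* [A i] (i >= 1) is the i-th point of a Poisson process of rate [lambda] on
   the half-line started at time 0; [A 0] is not a point but the time origin. *)
Definition poisson_points d (T : measurableType d) (R : realType)
    (P : probability T R) (lambda : R) (A : nat -> {RV P >-> R}) : Prop :=
  (forall w, A 0%N w = 0) /\
  iid_exponential [set: nat] lambda (interarrival A).

(* Stations are numbered 1, 2 and customers 1, 2, 3, ...; [S j i] is the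
   service time of customer [i] at station [j], and its values for other
   indices are irrelevant. *)
Definition service_index : set (nat * nat) :=
  [set ji | (1 <= ji.1 <= 2)%N && (1 <= ji.2)%N].

Record MMinfty_tandem d (T : measurableType d) (R : realType)
    (P : probability T R) (lambda mu : R) (A : nat -> {RV P >-> R})
    (S : nat -> nat -> {RV P >-> R}) : Prop := {
  tandem_arrivals : poisson_points lambda A ;
  tandem_services : iid_exponential service_index mu (fun ji => S ji.1 ji.2) ;
  tandem_independent :
    independent_families [set i | (1 <= i)%N] service_index
      A (fun ji => S ji.1 ji.2) }.

Definition departure d (T : measurableType d) (R : realType)
    (P : probability T R) (A : nat -> {RV P >-> R})
    (S : nat -> nat -> {RV P >-> R}) (j i : nat) (w : T) : R :=
  A i w + \sum_(1 <= l < j.+1) S l i w.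

Definition overlap d (T : measurableType d) (R : realType)
    (P : probability T R) (A : nat -> {RV P >-> R})
    (S : nat -> nat -> {RV P >-> R}) (j n m : nat) (w : T) : R :=
  Num.max (Num.min (departure A S j n w) (departure A S j m w)
           - Num.max (departure A S j.-1 n w) (departure A S j.-1 m w)) 0.

(* Main.v *)
From HB Require Import structures.
Require Import Defs.
From mathcomp Require Import all_boot all_order all_algebra finmap.
From mathcomp Require Import all_classical all_reals all_analysis.
From mathcomp Require Import measurable_realfun zify ring lra.

(** Let Delta be the time between the two arrivals, s1, s2 the service times of
    the first customer and t1, t2 those of the second one. As Delta is almost
    surely nonnegative, the two overlaps exceed x and y if and only if
    s1 > Delta + x, t1 > x, s2 > y, t2 > y, and the departures from station 1,
    which are |s1 - Delta - t1| apart, leave more than y of common service at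
    station 2. Distinguishing which customer leaves station 1 last splits this
    event, up to a null set, into two disjoint ones of the same shape,
      h(Delta) < a,  a + g(Delta) < b,  y < p,  y + (b - a - g(Delta)) < q,
    where (a, b) are the service times at station 1 and (p, q) those at
    station 2. If the second customer leaves first, (a, b, p, q) is
    (t1, s1, s2, t2) with h = x and g(Delta) = Delta; otherwise it is
    (s1, t1, t2, s2) with h = x + Delta and g(Delta) = - Delta.

    In such an event the variables p, q, b, a can be integrated out in this
    order, and each time the memoryless property gives the answer: for X
    exponential of rate r independent of Y,
      E[e^(phi(Y) - c X); theta(Y) < X]
        = r / (r + c) E[e^(phi(Y) - (r + c) theta(Y))]
    as long as theta(Y) >= 0 ([integral_exponential_threshold]). The result is
    e^(-2 mu y) / 4 times E[e^(- mu (g + 2 h)(Delta))]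
    ([probability_overlap_order]). In both cases g + 2 h = Delta + 2 x, so the
    two events have the same probability, and what remains is the Laplace
    transform at mu of Delta, a sum of k independent exponential inter-arrival
    times: (lambda / (lambda + mu)) ^ k ([integral_expR_sum_exponential]).

    Integrating out one variable is Tonelli's theorem once the joint law of
    (Y, X) is known to be a product. The service times are independent in the
    sense of events depending on one coordinate each, while Y gathers several
    of them, so that independence has to be propagated to tuples:
    [independent_of_family_pair] moves one member of an independent family
    into Y, by uniqueness of measures on rectangles. *)

Set Implicit Arguments.
Unset Strict Implicit.
Unset Printing Implicit Defensive.

Import Order.TTheory GRing.Theory Num.Theory.
Import numFieldNormedType.Exports.

Local Open Scope classical_set_scope.
Local Open Scope ring_scope.

(** * Independence of a variable from a family of random variables *)

Lemma eq_measure_rectangles d1 d2 (T1 : measurableType d1)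
    (T2 : measurableType d2) (R : realType)
    (m1 m2 : {measure set (T1 * T2) -> \bar R}) :
  (m1 setT < +oo)%E ->
  (forall A B, measurable A -> measurable B -> m1 (A `*` B) = m2 (A `*` B)) ->
  forall C, measurable C -> m1 C = m2 C.
Proof.
move=> m1oo m12 C mC.
pose G := [set A `*` B | A in @measurable _ T1 & B in @measurable _ T2].
apply: (measure_unique G (fun=> setT)) => //.
- exact: measurable_prod_measurableType.
- move=> _ _ [A mA [B mB <-]] [A' mA' [B' mB' <-]]; rewrite -setXI.
  exists (A `&` A'); first exact: measurableI.
  by exists (B `&` B') => //; exact: measurableI.
- by move=> _; exists setT => //; exists setT => //; rewrite setXTT.
- by rewrite bigcup_const.
- by move=> _ [A mA [B mB <-]]; exact: m12.
Qed.

(** Asking for the product of the individual probabilities on the right, and not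
    for the probability of the intersection, makes mutual independence of the
    family part of the notion (take [U] to be the whole space). This is what
    lets members of the family be moved into [Y] one after the other. *)
Definition independent_of_family d (T : measurableType d) (R : realType)
    (P : probability T R) d' (T' : measurableType d') (I : choiceType)
    (D : set I) (X : I -> {RV P >-> R}) (Y : T -> T') : Prop :=
  forall J : {fset I}, [set` J] `<=` D ->
  forall B : I -> set R, (forall i, measurable (B i)) ->
  forall U : set T', measurable U ->
  P (Y @^-1` U `&` \bigcap_(i in [set` J]) X i @^-1` B i) =
  (P (Y @^-1` U) * \prod_(i <- J) P (X i @^-1` B i))%E.


Section independent_of_family.
Context d (T : measurableType d) (R : realType) (P : probability T R).
Context d' (T' : measurableType d') (I : choiceType).
Variables (D : set I) (X : I -> {RV P >-> R}) (Y : T -> T').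
Hypothesis mY : measurable_fun setT Y.
Hypothesis indY : independent_of_family D X Y.

Lemma independent_of_member i : D i ->
  forall U B, measurable U -> measurable B ->
  P (Y @^-1` U `&` X i @^-1` B) = (P (Y @^-1` U) * P (X i @^-1` B))%E.
Proof.
move=> Di U B mU mB.
have iD : [set` [fset i]%fset] `<=` D by move=> j /=; rewrite inE => /eqP->.
have := indY iD (B := fun=> B) (fun=> mB) mU.
by rewrite big_seq_fset1 set_fset1 bigcap_set1.
Qed.

(** For a fixed event of the remaining family, both sides are finite measures of
    the set of values of the pair, and they agree on rectangles because there
    the condition on [X i] is one more condition on the family. *)
Lemma independent_of_family_pair i : D i ->
  independent_of_family (D `\ i) X (fun w => (Y w, X i w)).
Proof.
move=> Di J JD B mB C mC.
pose F := \bigcap_(j in [set` J]) X j @^-1` B j.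
have mF : measurable F.
  apply: fin_bigcap_measurable => // j _.
  by rewrite -[_ @^-1` _]setTI; exact: measurable_funP.
have JD' : [set` J] `<=` D by move=> j /JD[].
have PF : P F = (\prod_(j <- J) P (X j @^-1` B j))%E.
  have := indY JD' mB measurableT.
  by rewrite preimage_setT setTI probability_setT mul1e.
have PFfin : P F \is a fin_num by exact: fin_num_measure.
have PFge0 : (0 <= fine (P F))%R by rewrite fine_ge0.
have mZ : measurable_fun setT (fun w => (Y w, X i w)).
  by apply: measurable_fun_pair => //; exact: measurable_funP.
rewrite -PF -/F muleC -[X in (X * _)%E]fineK//.
pose c := NngNum PFge0.
pose m1 : {measure set (T' * R) -> \bar R} :=
  pushforward (mrestr P mF) (fun w => (Y w, X i w)).
pose m2 : {measure set (T' * R) -> \bar R} :=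
  mscale c (pushforward P (fun w => (Y w, X i w))).
apply: (@eq_measure_rectangles _ _ _ _ _ (m1 mZ) (m2 mZ)) mC.
  rewrite /= /pushforward /mrestr preimage_setT setTI.
  by rewrite ltey_eq fin_num_measure.
move=> U V mU mV; rewrite /= /mscale /= /pushforward /mrestr fineK//.
rewrite (_ : _ @^-1` _ = Y @^-1` U `&` X i @^-1` V)//.
rewrite independent_of_member// muleCA PF -setIA.
have iJ : i \notin J by apply/negP => /JD[_]; exact.
pose B' j := if j == i then V else B j.
have -> : X i @^-1` V `&` F =
    \bigcap_(j in [set` (i |` J)%fset]) X j @^-1` B' j.
  rewrite set_fsetU set_fset1 bigcap_setU bigcap_set1 /B' eqxx; congr (_ `&` _).
  apply: eq_bigcapr => j /= jJ; case: eqP => // ji.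
  by move: iJ; rewrite -ji jJ.
rewrite indY//; last 2 first.
- by move=> j; rewrite /= !inE => /orP[/eqP->//|]; exact: JD'.
- by move=> j; rewrite /B'; case: ifP.
rewrite big_fsetU1//= /B' eqxx; congr (_ * _)%E; rewrite muleC; congr (_ * _)%E.
rewrite big_seq [RHS]big_seq; apply: eq_bigr => j jJ; case: eqP => // ji.
by move: iJ; rewrite -ji jJ.
Qed.

(** The joint law of [Y] and [X i] is the product of their laws, so this is
    Tonelli's theorem pulled back to the sample space: [w'] is an independent
    copy of [w]. *)
Lemma ge0_integral_independent i (f : T' * R -> \bar R) : D i ->
  measurable_fun setT f -> (forall z, 0 <= f z)%E ->
  (\int[P]_w f (Y w, X i w) = \int[P]_w \int[P]_w' f (Y w, X i w'))%E.
Proof.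
move=> Di mf f0.
have mZ : measurable_fun setT (fun w => (Y w, X i w)).
  by apply: measurable_fun_pair => //; exact: measurable_funP.
pose Y' : {mfun T >-> T'} := HB.pack Y (isMeasurableFun.Build _ _ _ _ _ mY).
pose m : {measure set (T' * R) -> \bar R} :=
  pushforward P (fun w => (Y w, X i w)).
transitivity (\int[m mZ]_z f z)%E; first by rewrite ge0_integral_pushforward.
transitivity (\int[distribution P Y' \x distribution P (X i)]_z f z)%E.
  apply: eq_measure_integral => C mC _.
  apply/esym/product_measure_unique => // A B mA mB.
  exact: independent_of_member.
rewrite fubini_tonelli1// /fubini_F ge0_integral_distribution//; last first.
- by move=> y; exact: integral_ge0.
- exact: measurable_fun_fubini_tonelli_F.
apply: eq_integral => w _ /=; rewrite ge0_integral_distribution//.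
exact/measurableT_comp.
Qed.
End independent_of_family.

(** * Exponential laws *)

(** The exponential density is a version of the Radon-Nikodym derivative of the
    exponential law, for which the change of variables is known. *)
Lemma ge0_integral_exponential_prob (R : realType) (r : R)
    (f : measurableTypeR R -> \bar R) : 0 < r ->
  measurable_fun setT f -> (forall x, 0 <= f x)%E ->
  (\int[exponential_prob r]_x f x =
   \int[lebesgue_measure]_x (f x * (exponential_pdf r x)%:E))%E.
Proof.
move=> r0 mf f0.
pose nu : probability (measurableTypeR R) R := exponential_prob r.
pose mu : {sigma_finite_measure set (measurableTypeR R) -> \bar R} :=
  @lebesgue_measure R.
have mpdf : measurable_fun setT (EFin \o exponential_pdf r).
  by apply/measurable_EFinP; exact: measurable_exponential_pdf.
have nu_dom : nu r0 `<< mu.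
  apply/null_content_dominatesP => A mA A0.
  by apply: null_set_integral => //; exact: measurable_funTS.
rewrite -(Radon_Nikodym_SigmaFinite.change_of_variables nu_dom)//.
have mRN := Radon_Nikodym_SigmaFinite.f_integrable nu_dom.
have pdf_RN : ae_eq mu setT (Radon_Nikodym_SigmaFinite.f (nu r0) mu)
    (EFin \o exponential_pdf r).
  apply: integral_ae_eq => // A _ mA.
  by rewrite -Radon_Nikodym_SigmaFinite.f_integral.
apply: ae_eq_integral => //.
- by apply: emeasurable_funM => //; exact: measurable_int mRN.
- exact: emeasurable_funM.
- exact: ae_eqe_mul2l.
Qed.

Section exponential_rv.
Context d (T : measurableType d) (R : realType) (P : probability T R).
Variables (r : R) (X : {RV P >-> R}).
Hypotheses (r0 : 0 < r) (Xr : exponential_rv r X).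

Lemma ge0_integral_exponential_rv (f : R -> \bar R) :
  measurable_fun setT f -> (forall x, 0 <= f x)%E ->
  (\int[P]_w f (X w) =
   \int[lebesgue_measure]_x (f x * (exponential_pdf r x)%:E))%E.
Proof.
move=> mf f0; rewrite -ge0_integral_exponential_prob//.
(* [R] and [measurableTypeR R] have the same measurable sets under different
   displays, and Lebesgue measure lives on the latter. *)
have mX : measurable_fun setT (X : T -> measurableTypeR R).
  by move=> mD B mB; exact: (@measurable_funP _ _ _ _ setT X mD B mB).
pose X' : {mfun T >-> measurableTypeR R} :=
  HB.pack (X : T -> measurableTypeR R) (isMeasurableFun.Build _ _ _ _ _ mX).
rewrite -(ge0_integral_distribution (X' : {RV P >-> measurableTypeR R}))//.
pose nu : probability (measurableTypeR R) R := exponential_prob r.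
by apply: (eq_measure_integral (nu r0)) => A mA _; exact: Xr.
Qed.

(** Exponential tilting: the density of rate [r] times [expR (- (c * x))] is,
    up to the constant, the density of rate [r + c]. *)
Lemma integral_expR_exponential_rv c (A : set R) : 0 <= c -> measurable A ->
  (\int[P]_(w in X @^-1` A) (expR (- (c * X w)))%:E =
   (r / (r + c))%:E * exponential_prob (r + c) A)%E.
Proof.
move=> c0 mA.
rewrite integral_mkcond.
transitivity (\int[P]_w ((fun x => (expR (- (c * x)))%:E) \_ A) (X w))%E.
  by apply: eq_integral => w _; rewrite !patchE.
have mexp : measurable_fun setT (fun x : R => (expR (- (c * x)))%:E).
  by apply/measurable_EFinP/measurableT_comp => //; exact: measurable_funN.
rewrite ge0_integral_exponential_rv; last 2 first.
- exact/(measurable_restrictT _ _).1/measurable_funTS.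
- by move=> x; rewrite patchE; case: ifP => // _; rewrite lee_fin expR_ge0.
rewrite /exponential_prob -ge0_integralZl_EFin//; last 3 first.
- by move=> x _; rewrite lee_fin exponential_pdf_ge0// addr_ge0// ltW.
- by apply/measurable_funTS/measurable_EFinP; exact: measurable_exponential_pdf.
- by rewrite divr_ge0 ?addr_ge0// ltW.
rewrite [RHS]integral_mkcond; apply: eq_integral => x _.
rewrite !patchE; case: ifP => _; last by rewrite mul0e.
rewrite -!EFinM; congr EFin; have [x0|x0] := ltP x 0.
  by rewrite !lt0_exponential_pdf// !mulr0.
rewrite !exponential_pdfE//.
have -> : expR (- (r + c) * x) = expR (- (c * x)) * expR (- r * x).
  by rewrite -expRD; congr expR; ring.
field.
by rewrite gt_eqF// ltr_pwDl.
Qed.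

End exponential_rv.

Lemma exponential_prob_itv_bndy (R : realType) (r : R) (b : bool) (a : R) :
  0 < r -> 0 <= a ->
  exponential_prob r [set` Interval (BSide b a) +oo%O] = (expR (- (r * a)))%:E.
Proof.
move=> r0 a0.
transitivity (exponential_prob r `[a, +oo[).
  case: b => //; apply: integral_itv_obnd_cbnd.
  by apply/measurable_funTS/measurable_EFinP; exact: measurable_exponential_pdf.
rewrite /exponential_prob.
transitivity (\int[lebesgue_measure]_(x in `[a, +oo[)
    (r * expR (- r * x))%:E)%E.
  apply: eq_integral => x; rewrite inE/= in_itv/= andbT => ax.
  by rewrite exponential_pdfE// (le_trans a0).
have ce : continuous (fun z : R^o => expR (- r * z)).
  move=> z; apply: continuous_comp; last exact: continuous_expR.
  apply: continuousM => //.
  by apply: (@continuousN _ R^o); exact: cst_continuous.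
rewrite (@ge0_continuous_FTC2y _ _ (fun x => - expR (- r * x)) _ 0)//.
- by rewrite EFinN oppeK add0e mulNr.
- by move=> x _; rewrite mulr_ge0 ?expR_ge0// ltW.
- apply: continuous_subspaceT => z.
  by apply: cvgMr; exact: ce.
- rewrite -oppr0; apply: cvgN.
  rewrite (_ : (fun x => expR (- r * x)) =
               (fun z => expR (- z)) \o (fun z => r * z)); last first.
    by apply: eq_fun => x; rewrite mulNr.
  apply: (@cvg_comp _ _ _ _ _ _ (pinfty_nbhs R)); last exact: cvgr_expR.
  exact: gt0_cvgMry.
- by apply: cvgN; apply/cvg_at_right_filter; exact: ce.
- move=> z; rewrite in_itv/= andbT => az.
  have z0 : 0 < z by exact: le_lt_trans a0 az.
  by rewrite derive1_exponential_pdf ?exponential_pdfE ?ltW// in_itv/= z0.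
Qed.

(** * Integrating out one exponential variable *)

Lemma measurable_lteif d (T : measurableType d) (R : realType) (b : bool)
    (f g : T -> R) : measurable_fun setT f -> measurable_fun setT g ->
  measurable [set x | f x < g x ?<= if b].
Proof.
move=> mf mg; rewrite -[X in measurable X]setTI.
case: b; first exact: (measurable_fun_ler mf mg measurableT (Y := [set true])).
exact: (measurable_fun_ltr mf mg measurableT (Y := [set true])).
Qed.

(** One step of integration. Conditionally on [Y], the tilted law of [X i] is
    exponential of rate [r + c], whose tail beyond [theta (Y w)] is exponential
    because this threshold is nonnegative. The boolean [b] decides whether the
    threshold itself is included, which does not change the value. *)
Lemma integral_exponential_threshold d (T : measurableType d) (R : realType)
    (P : probability T R) d' (T' : measurableType d') (I : choiceType)
    (D : set I) (X : I -> {RV P >-> R}) (Y : T -> T') (i : I) (r c : R)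
    (b : bool) (V : set T') (theta phi : T' -> R) :
  measurable_fun setT Y -> independent_of_family D X Y -> D i ->
  0 < r -> exponential_rv r (X i) -> 0 <= c ->
  measurable V -> measurable_fun setT theta -> measurable_fun setT phi ->
  (forall y, V y -> 0 <= theta y) ->
  (\int[P]_(w in [set w | V (Y w) /\ theta (Y w) < X i w ?<= if b])
      (expR (phi (Y w) - c * X i w))%:E =
   (r / (r + c))%:E *
   \int[P]_(w in Y @^-1` V) (expR (phi (Y w) - (r + c) * theta (Y w)))%:E)%E.
Proof.
move=> mY indY Di r0 Xr c0 mV mth mphi th0.
pose C := [set z : T' * R | V z.1 /\ theta z.1 < z.2 ?<= if b].
pose f (z : T' * R) := (expR (phi z.1 - c * z.2))%:E.
have mC : measurable C.
  apply: measurableI.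
    by rewrite -[X in measurable X]setTI; exact: measurable_fst.
  by apply: measurable_lteif => //; exact: measurableT_comp.
have mf : measurable_fun setT f.
  apply/measurable_EFinP/measurableT_comp => //; apply: measurable_funB.
    exact: measurableT_comp.
  exact: measurable_funM.
rewrite integral_mkcond.
transitivity (\int[P]_w (f \_ C) (Y w, X i w))%E.
  by apply: eq_integral => w _; rewrite !patchE.
rewrite (ge0_integral_independent mY indY Di); last 2 first.
- by apply/(measurable_restrictT _ _).1 => //; exact: measurable_funTS.
- by move=> z; rewrite patchE; case: ifP => // _; rewrite lee_fin expR_ge0.
rewrite -ge0_integralZl_EFin//; last 3 first.
- by rewrite -[X in measurable X]setTI; exact: mY.
- apply/measurable_funTS/measurable_EFinP/measurableT_comp => //.
  apply: measurable_funB; first exact: measurableT_comp.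
  by apply: measurable_funM => //; exact: measurableT_comp.
- by rewrite divr_ge0 ?addr_ge0// ltW.
rewrite [RHS]integral_mkcond; apply: eq_integral => w _.
rewrite patchE; case: ifPn => [|/negP VY]; last first.
  rewrite integral0_eq// => w' _; rewrite patchE ifF//; apply/negP.
  by rewrite inE => -[/= Vw _]; apply: VY; rewrite inE.
rewrite inE/= => Vw.
transitivity (\int[P]_(w' in
      X i @^-1` [set` Interval (BSide b (theta (Y w))) +oo%O])
    ((expR (phi (Y w)))%:E * (expR (- (c * X i w')))%:E))%E.
  rewrite [RHS]integral_mkcond; apply: eq_integral => w' _.
  rewrite !patchE /f/= -EFinM -expRD.
  congr (if _ then _ else _); apply/idP/idP.
    by rewrite !inE/= in_itv/= andbT => -[].
  by rewrite !inE/= in_itv/= andbT.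
rewrite ge0_integralZl_EFin//; last 2 first.
- by rewrite -[X in measurable X]setTI; exact: measurable_funP.
- apply/measurable_funTS/measurable_EFinP/measurableT_comp => //.
  by apply: measurableT_comp => //; exact: measurable_funM.
rewrite (integral_expR_exponential_rv r0 Xr)//.
rewrite exponential_prob_itv_bndy ?th0 ?ltr_pwDl//.
by rewrite muleCA -!EFinM -expRD.
Qed.

(** * The event that the overlaps are large, for a fixed order of departures *)

(** Here [Delta] is the time between the arrivals, [a] and [b] index the
    services at station 1, [p] and [q] those at station 2, and
    [X b - X a - g Delta] is the time between the departures from station 1. Its
    nonnegativity makes the threshold for [q] nonnegative; those for [b] and [a]
    are nonnegative by the hypotheses on [h] and [g]. Integrating [p] and [q]
    gives just their tails; when [b] and [a] are integrated, they carry an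
    exponential weight of rate [mu] left by the previous variable, hence a
    factor 1/2 for each. *)
Lemma probability_overlap_order d (T : measurableType d) (R : realType)
    (P : probability T R) (I : choiceType) (D : set I)
    (X : I -> {RV P >-> R}) (Delta : T -> R) (a b p q : I) (mu y : R)
    (g h : R -> R) (c : bool) :
  measurable_fun setT Delta -> independent_of_family D X Delta ->
  (forall i, i \in [:: a; b; p; q] -> D i) -> uniq [:: a; b; p; q] ->
  0 < mu -> (forall i, D i -> exponential_rv mu (X i)) ->
  measurable_fun setT g -> measurable_fun setT h ->
  (forall t, 0 <= h t) -> (forall t, 0 <= h t + g t) -> 0 <= y ->
  P [set w | [/\ h (Delta w) < X a w,
    X a w + g (Delta w) < X b w ?<= if c,
    y < X p w & y + (X b w - X a w - g (Delta w)) < X q w]] =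
  ((expR (- 2 * mu * y) / 4)%:E *
   \int[P]_w (expR (- (mu * (g (Delta w) + 2 * h (Delta w)))))%:E)%E.
Proof.
move=> mDelta ind_D inD uniq_abpq mu0 Xexp mg mh h0 hg0 y0.
have [Da Db Dp Dq] : [/\ D a, D b, D p & D q].
  by split; apply: inD; rewrite !inE eqxx ?orbT.
have [ab ap aq bp bq] : [/\ b <> a, p <> a, q <> a, p <> b & q <> b].
  by split=> E; move: uniq_abpq; rewrite E /= !inE eqxx ?orbT ?andbF.
have pq : p <> q.
  by move=> E; move: uniq_abpq; rewrite E /= !inE eqxx ?orbT ?andbF.
pose Y1 w := (Delta w, X a w); pose Y2 w := (Y1 w, X b w).
pose Y3 w := (Y2 w, X q w).
have mY1 : measurable_fun setT Y1 by exact: measurable_fun_pair.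
have mY2 : measurable_fun setT Y2 by exact: measurable_fun_pair.
have mY3 : measurable_fun setT Y3 by exact: measurable_fun_pair.
have ind1 : independent_of_family (D `\ a) X Y1.
  exact: independent_of_family_pair.
have D1b : (D `\ a) b by [].
have ind2 : independent_of_family (D `\ a `\ b) X Y2.
  exact: independent_of_family_pair.
have D2q : (D `\ a `\ b) q by [].
have ind3 : independent_of_family (D `\ a `\ b `\ q) X Y3.
  exact: independent_of_family_pair.
have D3p : (D `\ a `\ b `\ q) p by [].
pose V1 := [set z : R * R | h z.1 < z.2].
pose V2 := [set z : R * R * R | V1 z.1 /\ z.1.2 + g z.1.1 < z.2 ?<= if c].
pose late (z : R * R * R) := y + (z.2 - z.1.2 - g z.1.1).
pose V3 := [set z : R * R * R * R | V2 z.1 /\ late z.1 < z.2].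
have mag : measurable_fun setT (fun z : R * R => z.2 + g z.1).
  by apply: measurable_funD => //; exact: measurableT_comp.
have mlate : measurable_fun setT late.
  apply: measurable_funD => //; apply: measurable_funB.
    by apply: measurable_funB => //; exact: measurableT_comp.
  by apply: measurableT_comp => //; exact: measurableT_comp.
have mV1 : measurable V1.
  by apply: (@measurable_lteif _ _ _ false) => //; exact: measurableT_comp.
have mV2 : measurable V2.
  apply: measurableI.
    by rewrite -[X in measurable X]setTI; exact: measurable_fst.
  by apply: measurable_lteif => //; exact: (measurableT_comp mag).
have mV3 : measurable V3.
  apply: measurableI.
    by rewrite -[X in measurable X]setTI; exact: measurable_fst.
  apply: (@measurable_lteif _ _ _ false) => //.
  exact: (measurableT_comp mlate).
have mE : measurable [set w | V3 (Y3 w) /\ y < X p w].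
  apply: measurableI; first by rewrite -[X in measurable X]setTI; exact: mY3.
  by apply: (@measurable_lteif _ _ _ false).
rewrite (_ : [set w | _] = [set w | V3 (Y3 w) /\ y < X p w]); last first.
  by apply/seteqP; split=> w /=; [case|case=> -[[]]].
rewrite -[LHS]mul1e -integral_cst//.
have step_p : (\int[P]_(w in [set w | V3 (Y3 w) /\ (y < X p w)%R]) cst 1 w =
    \int[P]_(w in Y3 @^-1` V3) (expR (- (mu * y)))%:E)%E.
  transitivity (\int[P]_(w in [set w | V3 (Y3 w) /\ y < X p w ?<= if false])
      (expR ((fun=> 0) (Y3 w) - 0 * X p w))%:E)%E.
    by apply: eq_integral => w _; rewrite mul0r subr0 expR0.
  rewrite (integral_exponential_threshold false mY3 ind3 D3p mu0 (Xexp _ Dp)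
    (theta := cst y) (phi := fun=> 0))//.
  rewrite addr0 divff ?gt_eqF// mul1e; apply: eq_integral => w _.
  by rewrite sub0r.
have step_q : (\int[P]_(w in Y3 @^-1` V3) (expR (- (mu * y)))%:E =
    \int[P]_(w in Y2 @^-1` V2)
      (expR (- (2 * mu * y) + mu * (X a w + g (Delta w)) - mu * X b w))%:E)%E.
  transitivity (\int[P]_(w in [set w | V2 (Y2 w) /\
        late (Y2 w) < X q w
        ?<= if false])
      (expR ((fun=> - (mu * y)) (Y2 w) - 0 * X q w))%:E)%E.
    by apply: eq_integral => w _; rewrite mul0r subr0.
  rewrite (integral_exponential_threshold false mY2 ind2 D2q mu0 (Xexp _ Dq)
    (phi := fun=> - (mu * y)))//; last first.
    move=> z [_ /lteifW zb]; rewrite addr_ge0// -addrA -opprD subr_ge0//.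
  rewrite addr0 divff ?gt_eqF// mul1e; apply: eq_integral => w _.
  by rewrite /late /=; congr (expR _)%:E; ring.
have half : mu / (mu + mu) = 2^-1 by field; rewrite gt_eqF ?addr_gt0.
have step_b : (\int[P]_(w in Y2 @^-1` V2)
      (expR (- (2 * mu * y) + mu * (X a w + g (Delta w)) - mu * X b w))%:E =
    2^-1%:E * \int[P]_(w in Y1 @^-1` V1)
      (expR (- (2 * mu * y) - mu * g (Delta w) - mu * X a w))%:E)%E.
  have := integral_exponential_threshold c
    (theta := fun z : R * R => z.2 + g z.1)
    (phi := fun z : R * R => - (2 * mu * y) + mu * (z.2 + g z.1))
    mY1 ind1 D1b mu0 (Xexp _ Db) (ltW mu0) mV1 mag.
  rewrite half => ->//.
  - congr (_ * _)%E; apply: eq_integral => w _ /=.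
    by congr (expR _)%:E; ring.
  - by apply: measurable_funD => //; exact: measurable_funM.
  - move=> z /ltW hz; apply: le_trans (hg0 z.1) _.
    by rewrite lerD2r.
have step_a : (\int[P]_(w in Y1 @^-1` V1)
      (expR (- (2 * mu * y) - mu * g (Delta w) - mu * X a w))%:E =
    2^-1%:E * \int[P]_w
      ((expR (- 2 * mu * y))%:E *
       (expR (- (mu * (g (Delta w) + 2 * h (Delta w)))))%:E))%E.
  have := integral_exponential_threshold false
    (theta := h) (phi := fun t : R => - (2 * mu * y) - mu * g t)
    mDelta ind_D Da mu0 (Xexp _ Da) (ltW mu0) measurableT mh.
  rewrite half => H.
  rewrite (_ : Y1 @^-1` V1 =
    [set w | setT (Delta w) /\ h (Delta w) < X a w ?<= if false]); last first.
    by apply/seteqP; split=> w //= [].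
  rewrite H//.
  - congr (_ * _)%E; apply: eq_integral => w _ /=.
    by rewrite -EFinM -expRD; congr (expR _)%:E; ring.
  - by apply: measurable_funB => //; exact: measurable_funM.
rewrite step_p step_q step_b step_a ge0_integralZl_EFin ?expR_ge0//.
  by rewrite !muleA -!EFinM; congr (_%:E * _)%E; field.
apply/measurable_EFinP/measurableT_comp => //; apply: measurableT_comp => //.
apply: measurable_funM => //; apply: measurable_funD.
  exact: measurableT_comp.
by apply: measurable_funM => //; exact: measurableT_comp.
Qed.

(** * Sums of independent exponential variables *)

Section sums_of_exponentials.
Context d (T : measurableType d) (R : realType) (P : probability T R).

Lemma independent_of_family_cst d' (T' : measurableType d') (I : choiceType)
    (D : set I) (X : I -> {RV P >-> R}) (t : T') :
  mutually_independent D X -> independent_of_family D X (fun=> t).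
Proof.
move=> indX J JD B mB U mU.
rewrite (preimage_cst t U); case: ifP => _.
  by rewrite setTI probability_setT mul1e indX.
by rewrite set0I measure0 mul0e.
Qed.

Lemma independent_of_family_comp d1 d2 (T1 : measurableType d1)
    (T2 : measurableType d2) (I : choiceType) (D : set I)
    (X : I -> {RV P >-> R}) (Y : T -> T1) (f : T1 -> T2) :
  measurable_fun setT f -> independent_of_family D X Y ->
  independent_of_family D X (fun w => f (Y w)).
Proof.
move=> mf indY J JD B mB U mU.
apply: (indY J JD B mB (f @^-1` U)).
by rewrite -[X in measurable X]setTI; exact: mf.
Qed.

Lemma exponential_rv_ge0 (r : R) (X : {RV P >-> R}) : 0 < r ->
  exponential_rv r X -> {ae P, forall w, 0 <= X w}.
Proof.
move=> r0 Xr; exists (~` (X @^-1` `[0, +oo[)).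
have mX0 : measurable (X @^-1` `[0, +oo[).
  by rewrite -[X in measurable X]setTI; exact: measurable_funP.
split; [exact: measurableC| |].
  rewrite probability_setC//.
  rewrite [X in (1 - X)%E](Xr `[0, +oo[%classic)//.
  by rewrite exponential_prob_itv_bndy// mulr0 oppr0 expR0 subee.
by move=> w /= nX; apply: contra_not nX; rewrite in_itv/= andbT.
Qed.

Variables (r : R) (X : nat -> {RV P >-> R}).
Hypothesis r0 : 0 < r.
Hypothesis Xr : iid_exponential [set: nat] r X.

Let partial n k w := \sum_(n <= l < n + k) X l w.

Let measurable_partial n k : measurable_fun setT (partial n k).
Proof. by apply: measurable_sum => l; exact: measurable_funP. Qed.

Let partialS n k w : partial n k.+1 w = partial n k w + X (n + k)%N w.
Proof. by rewrite /partial addnS big_nat_recr ?leq_addr. Qed.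

(** Keeping the whole tail of the family independent of the partial sum is what
    makes the induction go through. *)
Lemma independent_partial_sum n k :
  independent_of_family [set l | (n + k <= l)%N] X (partial n k).
Proof.
elim: k => [|k IHk].
  rewrite (_ : partial n 0 = fun=> 0); last first.
    by apply/funext => w; rewrite /partial addn0 big_geq.
  apply: independent_of_family_cst => J _.
  exact: Xr.1.
rewrite (_ : partial n k.+1 =
    fun w => partial n k w + X (n + k)%N w); last first.
  by apply/funext => w; rewrite partialS.
apply: (independent_of_family_comp (f := fun z : R * R => z.1 + z.2)
  (Y := fun w => (partial n k w, X (n + k)%N w))).
  by apply: measurable_funD.
have := independent_of_family_pair (measurable_partial n k) IHk (leqnn (n + k)).
move=> H J JD; apply: H => l /JD; rewrite /= addnS => nkl.
by split; [exact: ltnW|move=> E; rewrite E ltnn in nkl].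
Qed.

(** Each new summand is independent of the previous ones and contributes its own
    Laplace transform [r / (r + c)]. *)
Lemma integral_expR_sum_exponential n k (c : R) : 0 <= c ->
  (\int[P]_w (expR (- (c * \sum_(n <= l < n + k) X l w)))%:E =
   ((r / (r + c)) ^+ k)%:E)%E.
Proof.
move=> c0.
change (\int[P]_w (expR (- (c * partial n k w)))%:E =
  ((r / (r + c)) ^+ k)%:E)%E.
elim: k => [|k IHk].
  under eq_integral do rewrite /partial addn0 big_geq// mulr0 oppr0 expR0.
  by rewrite integral_cst// mul1e expr0; exact: probability_setT.
pose f (z : R * R) := (expR (- (c * z.1)) * expR (- (c * z.2)))%:E.
transitivity (\int[P]_w f (partial n k w, X (n + k)%N w))%E.
  apply: eq_integral => w _; rewrite /f -expRD.
  by congr (expR _)%:E; rewrite partialS /=; ring.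
rewrite (ge0_integral_independent (measurable_partial n k)
  (@independent_partial_sum n k))/=; last 3 first.
- exact: leqnn.
- apply/measurable_EFinP; apply: measurable_funM; apply: measurableT_comp => //;
    by apply: measurableT_comp => //; exact: measurable_funM.
- by move=> z; rewrite lee_fin mulr_ge0 ?expR_ge0.
transitivity (\int[P]_w
    ((r / (r + c))%:E * (expR (- (c * partial n k w)))%:E))%E.
  apply: eq_integral => w _; rewrite /f/=.
  under eq_integral do rewrite EFinM.
  rewrite ge0_integralZl_EFin ?expR_ge0//; last first.
    apply/measurable_EFinP/measurableT_comp => //.
    by apply: measurableT_comp => //; exact: measurable_funM.
  rewrite muleC; congr (_ * _)%E.
  rewrite -(preimage_setT (X (n + k)%N)).
  rewrite (integral_expR_exponential_rv r0 (Xr.2 _ I))//.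
  by rewrite [X in (_ * X)%E]integral_exponential_pdf ?ltr_pwDl// mule1.
rewrite ge0_integralZl_EFin//.
- by rewrite IHk -EFinM exprS.
- apply/measurable_EFinP/measurableT_comp => //.
  by apply: measurableT_comp => //; exact: measurable_funM.
- by rewrite divr_ge0 ?addr_ge0// ltW.
Qed.

End sums_of_exponentials.

(** * Arrivals, services and overlaps in the tandem queue *)

Lemma measurable_fun_sigma_generated d (T : measurableType d) (R : realType)
    (P : probability T R) (I : Type) (D : set I) (X : I -> {RV P >-> R}) i :
  D i ->
  measurable_fun setT (X i : g_sigma_algebraType
    (\bigcup_(i in D) preimage_set_system setT (X i) measurable) -> R).
Proof.
by move=> Di _ B mB; apply: sub_sigma_algebra; exists i => //; exists B.
Qed.

(** Events of finitely many members of [Z] belong to the sigma-algebra generated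
    by [Z], so the independence of the two sigma-algebras applies to them. *)
Lemma independent_families_of_family d (T : measurableType d) (R : realType)
    (P : probability T R) (I : Type) (J : choiceType) (D : set I) (E : set J)
    (X : I -> {RV P >-> R}) (Z : J -> {RV P >-> R}) (Y : T -> R) :
  independent_families D E X Z -> mutually_independent E Z ->
  measurable_fun setT (Y : g_sigma_algebraType
    (\bigcup_(i in D) preimage_set_system setT (X i) measurable) -> R) ->
  independent_of_family E Z Y.
Proof.
move=> indXZ indZ mY K KE B mB U mU.
rewrite -(indZ K KE B mB) indXZ//.
  by have := mY measurableT U mU; rewrite setTI.
pose G := \bigcup_(i in E) preimage_set_system setT (Z i) measurable.
suff : measurable (\bigcap_(i in [set` K]) Z i @^-1` B i :
    set (g_sigma_algebraType G)) by [].
apply: fin_bigcap_measurable => // i Ki.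
have := measurable_fun_sigma_generated (X := Z) (KE _ Ki) measurableT (mB i).
by rewrite setTI.
Qed.

Lemma measure_ae_eq_set d (T : measurableType d) (R : realType)
    (m : {measure set T -> \bar R}) (E F : set T) :
  measurable E -> measurable F -> {ae m, forall w, E w <-> F w} -> m E = m F.
Proof.
move=> mE mF [N [mN N0 EFN]].
rewrite -(measureU0 mE mN N0) -(measureU0 mF mN N0); congr (m _).
apply/seteqP; split=> w [|Nw]; try by right.
  by move=> Ew; have [|/EFN] := pselect (E w <-> F w); [case; left; auto|right].
by move=> Fw; have [|/EFN] := pselect (E w <-> F w); [case; left; auto|right].
Qed.

Lemma measurable_overlap d (T : measurableType d) (R : realType)
    (P : probability T R) (A : nat -> {RV P >-> R})
    (S : nat -> nat -> {RV P >-> R}) j n m :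
  measurable_fun setT (overlap A S j n m).
Proof.
have mdep i l : measurable_fun setT (departure A S i l).
  apply: measurable_funD => //.
  by apply: measurable_sum => s; exact: measurable_funP.
apply: measurable_maxr => //; apply: measurable_funB.
  exact: measurable_minr.
exact: measurable_maxr.
Qed.

Lemma lt_overlap (R : realDomainType) (x a b c d : R) : 0 <= x ->
  (x < Num.max (Num.min a b - Num.max c d) 0) =
  [&& x + c < a, x + c < b, x + d < a & x + d < b].
Proof.
move=> x0; rewrite lt_max [x < 0]ltNge x0 orbF ltrBrDr lt_min.
rewrite maxEle; case: ifP => cd.
  apply/andP/and4P => [[xa xb]|[]//]; split=> //;
    by apply: le_lt_trans xa || apply: le_lt_trans xb; rewrite lerD2l.
apply/andP/and4P => [[xa xb]|[]//]; split=> //;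
  by apply: le_lt_trans xa || apply: le_lt_trans xb;
    rewrite lerD2l ltW// ltNge cd.
Qed.

(** The alternative is the order of the departures from station 1: on the left,
    customer [m] does not leave it after customer [n]; on the right, it does.
    The bounds that are not listed, such as [S 1 n w > A m w - A n w + x] on the
    left, follow from the listed ones. *)
Lemma overlaps_gt d (T : measurableType d) (R : realType)
    (P : probability T R) (A : nat -> {RV P >-> R})
    (S : nat -> nat -> {RV P >-> R}) (n m : nat) (x y : R) (w : T) :
  0 <= x -> 0 <= y -> A n w <= A m w ->
  overlap A S 1 n m w > x /\ overlap A S 2 n m w > y <->
  [/\ x < S 1 m w, S 1 m w + (A m w - A n w) <= S 1 n w,
    y < S 2 n w & y + (S 1 n w - S 1 m w - (A m w - A n w)) < S 2 m w] \/
  [/\ x + (A m w - A n w) < S 1 n w, S 1 n w - (A m w - A n w) < S 1 m w,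
    y < S 2 m w & y + (S 1 m w - S 1 n w + (A m w - A n w)) < S 2 n w].
Proof.
move=> x0 y0 Anm.
have dep0 i : departure A S 0 i w = A i w.
  by rewrite /departure big_geq// addr0.
have dep1 i : departure A S 1 i w = A i w + S 1 i w.
  by rewrite /departure big_nat1.
have dep2 i : departure A S 2 i w = A i w + (S 1 i w + S 2 i w).
  by rewrite /departure big_nat_recr//= big_nat1.
rewrite /overlap !lt_overlap//= !(dep0, dep1, dep2); split.
  move=> [/and4P[h1 h2 h3 h4] /and4P[h5 h6 h7 h8]].
  have [le_ts|lt_st] := lerP (S 1 m w + (A m w - A n w)) (S 1 n w).
    by left; split=> //; lra.
  by right; split; lra.
by case=> -[h1 h2 h3 h4]; split; apply/and4P; split; lra.
Qed.

(** * The joint tail of the two overlap times *)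

Theorem theorem3p1 (R : realType) (d : measure_display)
    (T : measurableType d) (P : probability T R)
    (lambda mu : R) (A : nat -> {RV P >-> R})
    (S : nat -> nat -> {RV P >-> R})
    (lambda_gt0 : 0 < lambda) (mu_gt0 : 0 < mu)
    (tandem : MMinfty_tandem lambda mu A S)
    (n k : nat) (n_ge1 : (1 <= n)%N) (k_ge1 : (1 <= k)%N)
    (x y : R) (x_ge0 : 0 <= x) (y_ge0 : 0 <= y) :
  P [set w | overlap A S 1 n (n + k) w > x /\ overlap A S 2 n (n + k) w > y] =
  (expR (- 2 * mu * (x + y)) / 2 * (lambda / (lambda + mu)) ^+ k)%:E.
Proof.
have [[_ arrivals] [indS expS] indAS] := tandem.
set m := (n + k)%N.
pose Delta w := A m w - A n w.
(* [Delta] is nonnegative only almost surely, whereas the thresholds must be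
   nonnegative everywhere; its positive part is used instead. *)
pose lag w := Num.max (Delta w) 0.
have DeltaE w : Delta w = \sum_(n <= l < n + k) interarrival A l w.
  by rewrite /Delta -(telescope_sumr (fun l => A l w)) ?leq_addr.
have Delta_ge0 : {ae P, forall w, 0 <= Delta w}.
  have : {ae P, forall w, forall l, 0 <= interarrival A l w}.
    apply: ae_foralln => l; apply: (exponential_rv_ge0 lambda_gt0).
    exact: arrivals.2.
  by apply: filterS => w tau_ge0; rewrite DeltaE sumr_ge0.
have mDelta : measurable_fun setT Delta by exact: measurable_funB.
have mpos : measurable_fun setT (fun t : R => Num.max t 0).
  exact: measurable_maxr.
have mlag : measurable_fun setT lag by exact: (measurableT_comp mpos).
have ind_Delta : independent_of_family service_index
    (fun ji => S ji.1 ji.2) Delta.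
  apply: (independent_families_of_family indAS indS).
  apply: measurable_funB; apply: measurable_fun_sigma_generated => //=.
  by rewrite /m addn_gt0 n_ge1.
have lag_transform : (\int[P]_w (expR (- (mu * lag w)))%:E =
    ((lambda / (lambda + mu)) ^+ k)%:E)%E.
  rewrite -(integral_expR_sum_exponential lambda_gt0 arrivals n k (ltW mu_gt0)).
  apply: ae_eq_integral => //.
  - apply/measurable_EFinP/measurableT_comp => //.
    by apply: measurableT_comp => //; exact: measurable_funM.
  - apply/measurable_EFinP/measurableT_comp => //.
    apply: measurableT_comp => //; apply: measurable_funM => //.
    by apply: measurable_sum => l; exact: measurable_funP.
  - apply: filterS Delta_ge0 => w D0 _; rewrite -DeltaE /lag.
    by rewrite (max_idPl D0).
(* [E1] and [E2] are the two orders of departure from station 1. *)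
pose E1 := [set w | [/\ x < S 1 m w, S 1 m w + lag w <= S 1 n w,
  y < S 2 n w & y + (S 1 n w - S 1 m w - lag w) < S 2 m w]].
pose E2 := [set w | [/\ x + lag w < S 1 n w, S 1 n w - lag w < S 1 m w,
  y < S 2 m w & y + (S 1 m w - S 1 n w + lag w) < S 2 n w]].
have inS j i : (1 <= j <= 2)%N -> (1 <= i)%N -> service_index (j, i).
  by move=> j12 i1; rewrite /service_index /= j12.
have m_ge1 : (1 <= m)%N by rewrite /m addn_gt0 n_ge1.
have nm : (n == m) = false by apply/eqP; rewrite /m; lia.
have mn : (m == n) = false by rewrite eq_sym.
have lag_ge0 t : (0 : R) <= Num.max t 0 by rewrite le_max lexx orbT.
have discount : (\int[P]_w (expR (- (mu * (lag w + 2 * x))))%:E =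
    (expR (- 2 * mu * x) * (lambda / (lambda + mu)) ^+ k)%:E)%E.
  rewrite EFinM -lag_transform -ge0_integralZl_EFin ?expR_ge0//.
    apply: eq_integral => w _; rewrite -EFinM -expRD.
    by congr (expR _)%:E; ring.
  apply/measurable_EFinP/measurableT_comp => //; apply: measurableT_comp => //.
  exact: measurable_funM.
pose quarter := expR (- 2 * mu * (x + y)) / 4 * (lambda / (lambda + mu)) ^+ k.
have quarterE : quarter%:E = ((expR (- 2 * mu * y) / 4)%:E *
    (expR (- 2 * mu * x) * (lambda / (lambda + mu)) ^+ k)%:E)%E.
  rewrite -EFinM; congr EFin; rewrite /quarter mulrDr expRD; ring.
have PE1 : P E1 = quarter%:E.
  have := probability_overlap_order (a := (1, m)%N) (b := (1, n)%N)
    (p := (2, n)%N) (q := (2, m)%N) (g := fun t => Num.max t 0)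
    (h := cst x) true mDelta ind_Delta _ _ mu_gt0 expS mpos _ _ _ y_ge0.
  rewrite quarterE -discount; apply => //.
  - by move=> i; rewrite !inE => /or4P[] /eqP->; exact: inS.
  - by rewrite /= !inE !xpair_eqE mn nm.
  - by move=> t; rewrite addr_ge0.
have PE2 : P E2 = quarter%:E.
  have := probability_overlap_order (a := (1, n)%N) (b := (1, m)%N)
    (p := (2, m)%N) (q := (2, n)%N) (g := fun t => - Num.max t 0)
    (h := fun t => x + Num.max t 0) false mDelta ind_Delta _ _ mu_gt0 expS
    _ _ _ _ y_ge0.
  rewrite quarterE -discount => H.
  have -> : E2 = [set w | [/\ x + lag w < S 1 n w,
      S 1 n w + - lag w < S 1 m w ?<= if false, y < S 2 m w &
      y + (S 1 m w - S 1 n w - - lag w) < S 2 n w]].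
    by apply/seteqP; split=> w; rewrite /E2 /= opprK.
  rewrite H//.
  - congr (_ * _)%E; apply: eq_integral => w _; congr (expR _)%:E.
    by rewrite -/(lag w); ring.
  - by move=> i; rewrite !inE => /or4P[] /eqP->; exact: inS.
  - by rewrite /= !inE !xpair_eqE mn nm.
  - exact: measurableT_comp.
  - exact: measurable_funD.
  - by move=> t; rewrite addr_ge0.
  - by move=> t; rewrite addrK.
have and4 (B1 B2 B3 B4 : set T) : measurable B1 -> measurable B2 ->
    measurable B3 -> measurable B4 ->
    measurable [set w | [/\ B1 w, B2 w, B3 w & B4 w]].
  move=> mB1 mB2 mB3 mB4.
  rewrite (_ : [set w | _] = B1 `&` B2 `&` (B3 `&` B4)); last first.
    by apply/seteqP; split=> w [] // []// ? ? [].
  by apply: measurableI; exact: measurableI.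
have mS j i : measurable_fun setT (S j i) by exact: measurable_funP.
have mlt (u v : T -> R) : measurable_fun setT u -> measurable_fun setT v ->
    measurable [set w | u w < v w] by exact: (@measurable_lteif _ _ _ false).
have mE1 : measurable E1.
  apply: and4; first exact: mlt.
  - by apply: (@measurable_lteif _ _ _ true) => //; exact: measurable_funD.
  - exact: mlt.
  - apply: mlt => //; apply: measurable_funD => //.
    apply: measurable_funB => //.
    exact: measurable_funB.
have mE2 : measurable E2.
  apply: and4; last 3 first.
  - by apply: mlt => //; exact: measurable_funB.
  - exact: mlt.
  - apply: mlt => //; apply: measurable_funD => //.
    apply: measurable_funD => //.
    exact: measurable_funB.
  - by apply: mlt => //; exact: measurable_funD.
have E12 : E1 `&` E2 = set0.
  by rewrite -subset0 => w [[_ E1w _ _] [_ E2w _ _]]; lra.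
transitivity (P (E1 `|` E2)).
  apply: measure_ae_eq_set; [|exact: measurableU|].
    by apply: measurableI; apply: mlt => //; exact: measurable_overlap.
  apply: filterS Delta_ge0 => w Delta_ge0w.
  have lagE : lag w = A m w - A n w by exact: max_idPl.
  rewrite /E1 /E2 /= lagE; apply: overlaps_gt => //.
  by rewrite -subr_ge0.
transitivity (P E1 + P E2)%E; first by rewrite measureU.
rewrite PE1 PE2 -EFinD; congr EFin.
by rewrite /quarter; move: (_ ^+ k) => rho; field.
Qed.
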